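(* Let $(E,\rho)$ be a Polish space with Borel $\sigma$-algebra $\mathcal{B}(E)$, and let $(P_t)_{t\ge 0}$ be the semigroup of a time-homogeneous Markov process on $E$. Suppose that there are a positive measurable function $H$ on $E\times E$ and constants $\varepsilon\ge0$, $\kappa\ge1$ such that $$P_t\log f(x)\le\log P_tf(y)+H(x,y)(\varepsilon+t^{-\kappa})$$ for all $x,y\in E$, $t>0$ and all bounded measurable $f:E\to\mathbb{R}$ with $f\ge1$. Then for any $\alpha\in(0,1]$, $$P_t^\alpha\log f(x)\le\log P_t^\alpha f(y)+H(x,y)\left(\varepsilon+\frac{\Gamma\left(\frac{\kappa}{\alpha}\right)}{\alpha\, t^{\frac{\kappa}{\alpha}}\,\Gamma(\kappa)}\right)$$ for all $t>0$, $x,y\in E$ and all bounded measurable $f:E\to\mathbb{R}$ with $f\ge1$.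
   Context: $\Gamma$ is the Gamma function. For $\alpha\in(0,1]$, $\{\mu_t^\alpha\}_{t\ge0}$ denotes the convolution semigroup of probability measures on $[0,\infty)$ (that is, $\mu^\alpha_{t+s}=\mu^\alpha_t*\mu^\alpha_s$ and $\mu_t^\alpha\to\mu_0^\alpha=\delta_0$ weakly as $t\to0$) determined by the Laplace transform $$\int_0^\infty e^{-xs}\mu_t^\alpha(ds)=e^{-tx^\alpha},\qquad x\ge0,\ t\ge0.$$ The subordinated semigroup is $P_t^\alpha f(x):=\int_0^\infty P_sf(x)\,\mu_t^\alpha(ds)$, $t\ge0$ (it is assumed that $s\mapsto P_sf(x)$ is measurable, so that the integral makes sense). *)

(* Defs.v *)
From HB Require Import structures.
From mathcomp Require Import all_boot all_order all_algebra.
From mathcomp Require Import all_classical all_reals all_analysis.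

Set Implicit Arguments.
Unset Strict Implicit.
Unset Printing Implicit Defensive.

Import Order.TTheory GRing.Theory Num.Theory.
Import numFieldNormedType.Exports.

Local Open Scope classical_set_scope.
Local Open Scope ring_scope.

HB.mixin Record isSeparable T & Topological T := {
  separableT : exists2 D : set T, countable D & dense D
}.

#[short(type="polishType")]
HB.structure Definition Polish (K : numDomainType) :=
  {T of Metric K T & Complete T & isSeparable T}.

Notation borel E := (g_sigma_algebraType (@open E)).

Section defs.
Context {R : realType}.
Local Notation RB := (measurableTypeR R).

Section semigroup.
Context {d : measure_display} {T : measurableType d}.

Definition bounded_measurable (f : T -> R) : Prop :=
  measurable_fun setT f /\ bounded_fun f.

(* Transition semigroups of time-homogeneous Markov processes: the kernels
   [P t] are only constrained for [0 <= t]. *)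
Record markov_semigroup (P : R -> R.-pker T ~> T) : Prop := MarkovSemigroup {
  markov_semigroup0 : forall x A, measurable A -> P 0 x A = \d_x A ;
  markov_semigroupD : forall s t, 0 <= s -> 0 <= t ->
    forall x A, measurable A -> P (s + t) x A = kcomp_noparam (P s) (P t) x A
}.

Definition markov_op (P : R -> R.-pker T ~> T) (t : R) (f : T -> R) (x : T) : R :=
  \int[P t x]_y f y.

Definition subordinate_op (P : R -> R.-pker T ~> T) (mu : R -> probability RB R)
    (t : R) (f : T -> R) (x : T) : R :=
  \int[mu t]_(s in `[0, +oo[) markov_op P s f x.

End semigroup.

(* Measures on [0, +oo[ are measures on R giving full mass to [0, +oo[. *)
Record convolution_semigroup (mu : R -> probability RB R) : Prop :=
    ConvolutionSemigroup {
  csg_support : forall t, 0 <= t -> mu t `[0, +oo[%classic = 1%E ;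
  csg_conv : forall s t, 0 <= s -> 0 <= t -> forall A : set RB, measurable A ->
    mu (t + s) A =
    pushforward (mu t \x mu s)%E (fun z : RB * RB => z.1 + z.2 : RB) A ;
  csg0 : forall A : set RB, measurable A -> mu 0 A = \d_(0 : RB) A ;
  csg_weak_cvg : forall g : R -> R, continuous g -> bounded_fun g ->
    (\int[mu t]_s g s) @[t --> 0^'+] --> g 0
}.

Record stable_subordinator (alpha : R) (mu : R -> probability RB R) : Prop :=
    StableSubordinator {
  stable_csg : convolution_semigroup mu ;
  stable_laplace : forall x t, 0 <= x -> 0 <= t ->
    \int[mu t]_(s in `[0, +oo[) expR (- (x * s)) = expR (- (t * x `^ alpha))
}.

Definition Gamma (a : R) : R :=
  \int[lebesgue_measure]_(u in `]0, +oo[) (u `^ (a - 1) * expR (- u)).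

End defs.

(* Main.v *)
Require Import Defs.
From mathcomp Require Import all_boot all_order all_algebra.
From mathcomp Require Import all_classical all_reals all_analysis.
From mathcomp Require Import measurable_realfun.
From mathcomp Require Import lra ring.

Set Implicit Arguments.
Unset Strict Implicit.
Unset Printing Implicit Defensive.

Import Order.TTheory GRing.Theory Num.Theory.
Import numFieldNormedType.Exports.

Local Open Scope classical_set_scope.
Local Open Scope ring_scope.

(* Since [mu t] has no atom at 0, the log-Harnack inequality can be integrated
   in [s > 0] against [mu t].  The logarithm is dealt with by Jensen's
   inequality, in the form of the tangent bound [ln z <= ln m + (z / m - 1)] at
   the mean [m].  The remaining term is the moment of order [- kappa] of
   [mu t]: writing [Gamma kappa * s `^ (- kappa)] as the integral of
   [u `^ (kappa - 1) * expR (- (s * u))] and exchanging the integrals turns it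
   into an integral of the Laplace transform, which the substitution
   [w = t * u `^ alpha] reduces to [Gamma (kappa / alpha)]. *)

(** * Change of variables by a power function on the positive half-line *)

Section power_substitution.
Context {R : realType}.
Local Notation leb := (@lebesgue_measure R).
Local Notation RB := (measurableTypeR R).
Implicit Types a c p u x : R.

(** Monotone convergence along intervals increasing to ]0, +oo[. The endpoints are left general
    because the lemma serves both for [[l n, r n]] and for its image under the substitution. *)
Lemma cvg_integral_itv_pos (l r : nat -> R) (h : RB -> \bar R) :
  nonincreasing_seq l -> nondecreasing_seq r ->
  (forall n, 0 < l n) ->
  (forall x, 0 < x -> exists n, l n <= x <= r n) ->
  measurable_fun (`]0, +oo[%classic : set RB) h ->
  (forall x, 0 < x -> (0 <= h x)%E) ->
  (\int[leb]_(x in `[l n, r n]) h x)%E @[n --> \oo] -->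
  (\int[leb]_(x in `]0%R, +oo[) h x)%E.
Proof.
move=> dl dr l0 lr mh h0.
have sub n : `[l n, r n] `<=` `]0, +oo[.
  move=> x /=; rewrite !in_itv/= andbT => /andP[lx _].
  exact: lt_le_trans (l0 n) lx.
rewrite (_ : `]0, +oo[%classic = \bigcup_n `[l n, r n]%classic); last first.
  apply/seteqP; split => [x|x [n _]]; last exact: sub.
  rewrite /= in_itv/= andbT => /lr[n lxr].
  by exists n.
apply: ge0_nondecreasing_set_cvg_integral.
- move=> m n mn; apply/subsetPset; apply: subset_itv; rewrite bnd_simp.
  + exact: dl.
  + exact: dr.
- by move=> n; exact: measurable_itv.
- by move=> n; apply: measurable_funS mh => //; exact: sub.
- by move=> n x /sub/=; rewrite in_itv/= andbT; exact: h0.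
Qed.

Lemma continuous_powR p : {in `]0, +oo[, continuous (fun x : R => x `^ p)}.
Proof.
move=> x; rewrite in_itv/= andbT => x0.
apply/differentiable_continuous/derivable1_diffP.
by apply: derivable_powR; rewrite in_itv/= andbT.
Qed.

(* The endpoint behaviour of the derivative of [c * u `^ p] is irrelevant once
   ]0, +oo[ is exhausted by the intervals [1/(n+1), n+1]. *)
Lemma ge0_integral_powR_subst c p (G : R -> R) : 0 < c -> 0 < p ->
  {in `]0, +oo[, continuous G} -> (forall x, 0 < x -> 0 <= G x) ->
  (\int[leb]_(x in `]0%R, +oo[) (G x)%:E =
   \int[leb]_(u in `]0%R, +oo[)
      (G (c * u `^ p) * (c * (p * u `^ (p - 1))))%:E)%E.
Proof.
move=> c0 p0 cG G0.
pose F u := c * u `^ p.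
have F0 u : 0 < u -> 0 < F u by move=> u0; rewrite mulr_gt0// powR_gt0.
have homoF x y : 0 < x -> x < y -> F x < F y.
  move=> x0 xy; rewrite /F ltr_pM2l// gt0_ltr_powR// nnegrE ltW//.
  exact: lt_trans xy.
have homoF' x y : 0 < x -> x <= y -> F x <= F y.
  by move=> x0; rewrite le_eqVlt => /predU1P[->//|/(homoF _ _ x0)/ltW].
have drvF x : 0 < x -> is_derive x 1 F (c * (p * x `^ (p - 1))).
  by move=> x0; apply: is_deriveZ; exact: is_derive1_powR.
have F'E x : 0 < x -> derive1 F x = c * (p * x `^ (p - 1)).
  by move=> x0; rewrite derive1E; have [] := drvF x x0.
have cF : {in `]0, +oo[, continuous F}.
  by move=> x x0; apply: cvgM; [exact: cvg_cst|exact: continuous_powR].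
have cE : {in `]0, +oo[, continuous (fun u => c * (p * u `^ (p - 1)))}.
  move=> x x0; apply: cvgM; first exact: cvg_cst.
  by apply: cvgM; [exact: cvg_cst|exact: continuous_powR].
have cF' : {in `]0, +oo[, continuous (derive1 F)}.
  move=> x x0; have := cE x x0.
  rewrite /continuous_at F'E; last by move: x0; rewrite in_itv/= andbT.
  (* The closed form of the derivative is known at positive points only, so the two functions are
     compared near [x], which suffices for the limit. *)
  apply: cvg_trans; apply: near_eq_cvg.
  have := x0; rewrite in_itv/= andbT => x0'.
  by near=> z; rewrite F'E//; near: z; exact: lt_nbhsr.
have mco (h : R -> R) : {in `]0, +oo[, continuous h} ->
    measurable_fun (`]0, +oo[%classic : set RB) (EFin \o h : RB -> \bar R).
  move=> ch; apply/measurable_EFinP.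
  apply: open_continuous_measurable_fun; first exact: interval_open.
  by move=> x; rewrite inE/= => x0; apply: ch.
(* The shift by one keeps the endpoints positive and gives [l n <= 1 <= r n]. *)
pose l (n : nat) : R := n.+1%:R^-1.
pose r (n : nat) : R := n.+1%:R.
have l0 n : 0 < l n by rewrite invr_gt0.
have dl : nonincreasing_seq l.
  by move=> m n mn; rewrite lef_pV2 ?posrE// ler_nat ltnS.
have dr : nondecreasing_seq r by move=> m n mn; rewrite ler_nat ltnS.
have lr1 n : l n <= r n.
  by apply: (@le_trans _ _ 1); rewrite /l /r ?invf_le1 ?ler1n.
have lrx x : 0 < x -> exists n, l n <= x <= r n.
  (* The Archimedean property is applied to [x] for the right endpoint and to its inverse for the
     left one. *)
  move=> x0.
  have [m xm] : exists m, x <= r m.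
    exists (Num.truncn x); apply/ltW.
    by have := truncnS_gt x.
  have [k xk] : exists k, x^-1 <= r k.
    exists (Num.truncn x^-1); apply/ltW.
    by have := truncnS_gt x^-1.
  exists (maxn m k); apply/andP; split.
    rewrite -(invrK x) /l lef_pV2 ?posrE ?invr_gt0//.
    by apply: le_trans xk _; apply: dr; exact: leq_maxr.
  by apply: le_trans xm _; apply: dr; exact: leq_maxl.
have cG' :
    {in `]0, +oo[, continuous (fun u => G (F u) * (c * (p * u `^ (p - 1))))}.
  move=> x x0; apply: cvgM; last exact: cE.
  apply: continuous_comp; first exact: cF.
  by apply: cG; move: x0; rewrite !in_itv/= !andbT; exact: F0.
have L1 := @cvg_integral_itv_pos (F \o l) (F \o r) (EFin \o G).
have L2 := @cvg_integral_itv_pos l r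
  (EFin \o (fun u => G (F u) * (c * (p * u `^ (p - 1))))).
have {}L1 : (\int[leb]_(x in `[F (l n), F (r n)]) (G x)%:E)%E @[n --> \oo] -->
  (\int[leb]_(x in `]0%R, +oo[) (G x)%:E)%E.
  apply: L1.
  - by move=> m n mn; apply: homoF' => //; exact: dl.
  - move=> m n mn; apply: homoF'; last exact: dr.
    by rewrite /r.
  - by move=> n; exact: F0.
  - move=> x x0.
    (* This is the preimage of [x] under [F]; by monotonicity, an interval around it is sent to an
       interval around [x]. *)
    have y0 : 0 < (x / c) `^ p^-1 by rewrite powR_gt0// divr_gt0.
    have Fy : F ((x / c) `^ p^-1) = x.
      rewrite /F -powRrM mulVf ?gt_eqF// powRr1 ?divr_ge0 ?ltW//.
      by rewrite mulrCA divff ?gt_eqF// mulr1.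
    have [n /andP[ly yr]] := lrx _ y0; exists n.
    by rewrite -Fy /= !homoF'.
  - exact: mco.
  - by move=> x x0; rewrite lee_fin; exact: G0.
have {}L2 : (\int[leb]_(x in `[l n, r n])
   (G (F x) * (c * (p * x `^ (p - 1))))%:E)%E @[n --> \oo] -->
  (\int[leb]_(x in `]0%R, +oo[) (G (F x) * (c * (p * x `^ (p - 1))))%:E)%E.
  apply: L2 => //.
  - exact: mco.
  - move=> x x0; rewrite lee_fin mulr_ge0 ?G0 ?F0//.
    by rewrite !mulr_ge0 ?powR_ge0// ltW.
(* On a compact interval away from 0 everything is continuous, so classical substitution applies;
   the two sides of the goal are then limits of one sequence. *)
have E n : (\int[leb]_(x in `[F (l n), F (r n)]) (G x)%:E =
   \int[leb]_(x in `[l n, r n]) (G (F x) * (c * (p * x `^ (p - 1))))%:E)%E.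
  rewrite (@integration_by_substitution_increasing _ F G (l n) (r n) (lr1 n)).
  - apply: eq_integral => x; rewrite inE/= in_itv/= => /andP[lx _].
    by rewrite fctE/= F'E//; exact: lt_le_trans (l0 n) lx.
  - move=> x y; rewrite in_itv/= => /andP[lx _] _.
    by apply: homoF; exact: lt_le_trans (l0 n) lx.
  - move=> x; rewrite in_itv/= => /andP[lx _]; apply: cF'.
    by rewrite in_itv/= andbT (lt_trans (l0 n) lx).
  - apply: (cvgP (derive1 F (l n))); apply: cvg_at_right_filter.
    by apply: cF'; rewrite in_itv/= andbT.
  - apply: (cvgP (derive1 F (r n))); apply: cvg_at_left_filter.
    by apply: cF'; rewrite in_itv/= andbT /r.
  - split.
    + move=> x; rewrite in_itv/= => /andP[lx _].
      by apply: (@ex_derive _ _ _ _ _ _ _ (drvF x _)); exact: lt_trans lx.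
    + by apply: cvg_at_right_filter; apply: cF; rewrite in_itv/= andbT.
    + by apply: cvg_at_left_filter; apply: cF; rewrite in_itv/= andbT /r.
  - apply: continuous_in_subspaceT => x; rewrite inE/= in_itv/= => /andP[lx _].
    by apply: cG; rewrite in_itv/= andbT; exact: lt_le_trans (F0 _ (l0 n)) lx.
apply: (cvg_unique _ L1) => //; move: L2.
have <- : (fun n => (\int[leb]_(x in `[F (l n), F (r n)]) (G x)%:E)%E) =
    (fun n => (\int[leb]_(x in `[l n, r n])
       (G (F x) * (c * (p * x `^ (p - 1))))%:E)%E) by exact/funext.
exact.
Unshelve. all: by end_near. Qed.

End power_substitution.

(** * Tonelli's theorem on a measurable rectangle *)

Section fubini.
Context {R : realType}.
Context {d1 d2 : measure_display}.
Context {T1 : measurableType d1} {T2 : measurableType d2}.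

(** Extension of [f] by 0 outside the rectangle reduces this to Tonelli's theorem on the whole
    product. *)
Lemma fubini_tonelli_in (m1 : {sigma_finite_measure set T1 -> \bar R})
    (m2 : {sigma_finite_measure set T2 -> \bar R}) (A : set T1) (B : set T2)
    (f : T1 * T2 -> \bar R) :
  measurable A -> measurable B -> measurable_fun (A `*` B) f ->
  (forall x y, A x -> B y -> (0 <= f (x, y))%E) ->
  (\int[m1]_(x in A) \int[m2]_(y in B) f (x, y) =
   \int[m2]_(y in B) \int[m1]_(x in A) f (x, y))%E.
Proof.
move=> mA mB mf f0.
pose g := f \_ (A `*` B).
have gE x y : g (x, y) = if (x \in A) && (y \in B) then f (x, y) else 0%E.
  by rewrite /g patchE in_setX.
have <- : (\int[m1]_x \int[m2]_y g (x, y) =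
    \int[m1]_(x in A) \int[m2]_(y in B) f (x, y))%E.
  rewrite [RHS]integral_mkcond; apply: eq_integral => x _.
  rewrite patchE; case: ifPn => xA.
    rewrite [RHS]integral_mkcond; apply: eq_integral => y _.
    by rewrite gE xA patchE.
  by apply: integral0_eq => y _; rewrite gE (negbTE xA).
have <- : (\int[m2]_y \int[m1]_x g (x, y) =
    \int[m2]_(y in B) \int[m1]_(x in A) f (x, y))%E.
  rewrite [RHS]integral_mkcond; apply: eq_integral => y _.
  rewrite patchE; case: ifPn => yB.
    rewrite [RHS]integral_mkcond; apply: eq_integral => x _.
    by rewrite gE yB andbT patchE.
  by apply: integral0_eq => x _; rewrite gE (negbTE yB) andbF.
apply: fubini_tonelli.
  by apply/(measurable_restrictT f) => //; exact: measurableX.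
move=> [x y]; rewrite gE; case: ifPn => // /andP[]; rewrite !inE.
exact: f0.
Qed.

End fubini.

(** * Finiteness and positivity of the Gamma integral *)

Section Gamma.
Context {R : realType}.
Local Notation leb := (@lebesgue_measure R).
Local Notation RB := (measurableTypeR R).
Implicit Types a c p u x : R.

(** Concavity of the logarithm, from ln (1 + v) <= v at v = z / m - 1. *)
Lemma ln_le_tangent (m z : R) : 0 < m -> 0 < z -> ln z <= ln m + (z / m - 1).
Proof.
move=> m0 z0; rewrite -lerBlDl -ln_div ?posrE//.
rewrite -[in leLHS](subrKC 1 (z / m)) le_ln1Dx//.
by rewrite ltrBrDl subrr divr_gt0.
Qed.

(** Take the tangent bound for ln u at the point 2a, multiply by a and drop the term -a. The rate
    1/2 leaves half of the decay of exp (-u) for integrability. The case a = 0 is separate, since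
    the tangent point must be positive. *)
Lemma powR_le_expR a u : 0 <= a -> 0 < u ->
  u `^ a <= expR (a * ln (2 * a)) * expR (2^-1 * u).
Proof.
rewrite le_eqVlt => /predU1P[<- u0|a0 u0].
  rewrite powRr0 mul0r expR0 mul1r.
  by rewrite -expR0 ler_expR mulr_ge0 ?invr_ge0 ?ltW.
rewrite /powR gt_eqF// -expRD ler_expR.
have a2 : 0 < 2 * a by rewrite mulr_gt0.
have := ln_le_tangent a2 u0; rewrite -(ler_pM2l a0) => /le_trans; apply.
rewrite mulrDr lerD2l mulrBr mulr1.
rewrite (_ : a * (u / (2 * a)) = 2^-1 * u); last by field; lra.
by lra.
Qed.

Lemma measurable_expRNM c :
  measurable_fun setT (fun u : RB => expR (- (c * u))).
Proof. by do 2 apply: measurableT_comp => //. Qed.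

(** Up to the factor 1/c the integrand is the exponential density, whose total mass is 1. *)
Lemma integral_expRNM_lty c : 0 < c ->
  (\int[leb]_(x in `]0%R, +oo[) (expR (- (c * x)))%:E < +oo)%E.
Proof.
move=> c0.
apply: (@le_lt_trans _ _
   (\int[leb]_x (c^-1%:E * (exponential_pdf c x)%:E))%E).
  apply: (@le_trans _ _
   (\int[leb]_(x in `]0%R, +oo[) (c^-1%:E * (exponential_pdf c x)%:E))%E).
    rewrite le_eqVlt; apply/orP; left; apply/eqP; apply: eq_integral => x.
    rewrite inE/= in_itv/= andbT => x0; rewrite exponential_pdfE ?ltW//.
    by rewrite -EFinM mulrA mulVf ?gt_eqF// mul1r mulNr.
  apply: ge0_subset_integral => //.
    apply/measurable_EFinP/measurable_funM => //.
    exact: measurable_exponential_pdf.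
  move=> x _; rewrite -EFinM lee_fin.
  by rewrite mulr_ge0 ?exponential_pdf_ge0 ?invr_ge0 ?(ltW c0).
rewrite ge0_integralZl//.
- by rewrite integral_exponential_pdf// mule1 ltry.
- by apply/measurable_EFinP; exact: measurable_exponential_pdf.
- by move=> x _; rewrite lee_fin exponential_pdf_ge0 ?ltW.
- by rewrite lee_fin invr_ge0 ltW.
Qed.

Lemma measurable_powRM_expR (b : R) :
  measurable_fun setT (fun u : RB => u `^ b * expR (- u)).
Proof.
apply: measurable_funM; first exact: measurable_powR.
by apply: measurableT_comp => //; exact: measurable_oppr.
Qed.

(** With a nonnegative exponent a - 1, the integrand is dominated by a multiple of exp (-u/2). The
    range a >= 1 covers both [kappa] and [kappa / alpha]. *)
Lemma Gamma_lty a : 1 <= a ->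
  (\int[leb]_(u in `]0%R, +oo[) (u `^ (a - 1) * expR (- u))%:E < +oo)%E.
Proof.
move=> a1; have a0 : 0 <= a - 1 by rewrite subr_ge0.
set C := expR ((a - 1) * ln (2 * (a - 1))).
apply: (@le_lt_trans _ _
   (\int[leb]_(x in `]0%R, +oo[) (C%:E * (expR (- (2^-1 * x)))%:E))%E).
  apply: ge0_le_integral => //.
  - by move=> x _; rewrite lee_fin mulr_ge0 ?powR_ge0 ?expR_ge0.
  - by apply/measurable_EFinP/measurable_funTS; exact: measurable_powRM_expR.
  - apply/measurable_EFinP/measurable_funTS; apply: measurable_funM => //.
    exact: measurable_expRNM.
  - move=> x; rewrite /= in_itv/= andbT => x0.
    rewrite -EFinM lee_fin.
    apply: (le_trans (ler_wpM2r (expR_ge0 (- x)) (powR_le_expR a0 x0))).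
    rewrite -mulrA -expRD le_eqVlt; apply/orP; left; apply/eqP.
    by congr (_ * expR _); field.
rewrite ge0_integralZl//.
- by rewrite lte_mul_pinfty ?lee_fin ?expR_ge0//; exact: integral_expRNM_lty.
- apply/measurable_EFinP/measurable_funTS.
  exact: measurable_expRNM.
- by rewrite lee_fin expR_ge0.
Qed.

(** [Gamma] is the real part of an extended integral; finiteness makes the two values agree. *)
Lemma GammaE a : 1 <= a ->
  (Gamma a)%:E =
  (\int[leb]_(u in `]0%R, +oo[) (u `^ (a - 1) * expR (- u))%:E)%E.
Proof.
move=> a1; rewrite /Gamma /Rintegral fineK// ge0_fin_numE ?Gamma_lty//.
by apply: integral_ge0 => x _; rewrite lee_fin mulr_ge0 ?powR_ge0 ?expR_ge0.
Qed.

Lemma Gamma_gt0 a : 1 <= a -> 0 < Gamma a.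
Proof.
move=> a1; rewrite -lte_fin GammaE//.
have mf : measurable_fun (setT : set RB)
    (fun u => (u `^ (a - 1) * expR (- u))%:E).
  by apply/measurable_EFinP; exact: measurable_powRM_expR.
have f0 x : (0 <= (x `^ (a - 1) * expR (- x))%:E)%E.
  by rewrite lee_fin mulr_ge0 ?powR_ge0 ?expR_ge0.
(* On [1, 2] the power is at least 1 and the exponential at least exp (-2), which gives a positive
   lower bound. *)
apply: (@lt_le_trans _ _ (\int[leb]_(u in `[1%R, 2%R]) (expR (-2))%:E)%E).
  rewrite integral_cst//= lebesgue_measure_itv/= lte_fin ltr1n.
  by rewrite -EFinB mule_gt0// lte_fin ?expR_gt0// subr_gt0 ltr1n.
apply: (@le_trans _ _
   (\int[leb]_(u in `[1%R, 2%R]) (u `^ (a - 1) * expR (- u))%:E)%E).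
  apply: ge0_le_integral => //.
  - exact: measurable_funTS.
  - move=> x; rewrite /= in_itv/= => /andP[x1 x2]; rewrite lee_fin.
    rewrite -[leLHS]mul1r ler_pM ?expR_ge0//; last by rewrite ler_expR lerN2.
    by rewrite -[leLHS](powRr0 x) ler_powR ?subr_ge0.
apply: ge0_subset_integral => //; first exact: measurable_funTS.
move=> x; rewrite /= !in_itv/= => /andP[x1 _].
by rewrite andbT (lt_le_trans _ x1).
Qed.

End Gamma.

(** Integrability from an explicit uniform bound, the form in which bounds are available for Laplace
    kernels, constants and the semigroup. *)
Lemma measurable_le_integrable d (T : measurableType d) (R : realType)
    (m : {measure set T -> \bar R}) (A : set T) (h : T -> R) (M : R) :
  measurable A -> (m A < +oo)%E -> measurable_fun A h ->
  (forall x, A x -> `|h x| <= M) ->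
  m.-integrable A (EFin \o h).
Proof.
move=> mA mAoo mh hM; apply: measurable_bounded_integrable => //.
exists M; split; first exact: num_real.
by move=> x Mx y Ay; apply: le_trans (hM y Ay) (ltW Mx).
Qed.

(** * The stable law: absence of an atom at 0 and negative moments *)

Section stable.
Context {R : realType}.
Local Notation leb := (@lebesgue_measure R).
Local Notation RB := (measurableTypeR R).

Lemma integral_powR_expR (al k c : R) : 0 < al -> 1 <= k / al -> 0 < c ->
  (\int[leb]_(u in `]0%R, +oo[) (u `^ (k - 1) * expR (- (c * u `^ al)))%:E =
   (Gamma (k / al) / (al * c `^ (k / al)))%:E)%E.
Proof.
move=> al0 ka c0.
set I := LHS.
have K0 : 0 < al * c `^ (k / al) by rewrite mulr_gt0// powR_gt0.
(* Clearing the denominator avoids arguing first that [I] is finite. *)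
suff E : ((Gamma (k / al))%:E = (al * c `^ (k / al))%:E * I)%E.
  rewrite mulrC EFinM E muleA -EFinM.
  by rewrite mulVf ?gt_eqF// mul1e.
rewrite GammaE// (ge0_integral_powR_subst
  (G := fun w : R => w `^ (k / al - 1) * expR (- w)) c0 al0); last 2 first.
- move=> x x0; apply: cvgM; first exact: continuous_powR.
  by apply: continuous_comp; [exact: continuousN|exact: continuous_expR].
- by move=> x _; rewrite mulr_ge0 ?powR_ge0 ?expR_ge0.
rewrite -ge0_integralZl//; last 3 first.
- apply/measurable_EFinP/measurable_funTS/measurable_funM.
    exact: measurable_powR.
  apply: measurableT_comp => //; apply: measurableT_comp => //.
  by apply: measurable_funM => //; exact: measurable_powR.
- by move=> x _; rewrite lee_fin mulr_ge0 ?powR_ge0 ?expR_ge0.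
- by rewrite lee_fin ltW.
(* After w = c u^al, the factors w^(k/al - 1) and c al u^(al - 1) multiply to al c^(k/al) u^(k -
   1). *)
apply: eq_integral => u; rewrite inE/= in_itv/= andbT => u0.
rewrite -EFinM; congr EFin.
rewrite powRM ?powR_ge0 ?ltW// -powRrM.
rewrite (_ : al * (k / al - 1) = k - al); last by field; rewrite gt_eqF.
have -> : c `^ (k / al) = c `^ (k / al - 1) * c.
  transitivity (c `^ (k / al - 1) * c `^ 1); last by rewrite (powRr1 (ltW c0)).
  by rewrite -powRD ?subrK// (gt_eqF c0) implybT.
have -> : u `^ (k - 1) = u `^ (k - al) * u `^ (al - 1).
  rewrite -powRD; last by rewrite (gt_eqF u0) implybT.
  by congr (_ `^ _); ring.
by ring.
Qed.

Variables (nu : probability RB R) (t al : R).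
Hypothesis t0 : 0 < t.
Hypothesis al01 : 0 < al <= 1.
Hypothesis laplace : forall x, 0 <= x ->
  \int[nu]_(s in `[0, +oo[) expR (- (x * s)) = expR (- (t * x `^ al)).

Let al0 : 0 < al. Proof. by case/andP: al01. Qed.

Lemma integrable_expRNM x : 0 <= x ->
  nu.-integrable `[0, +oo[ (EFin \o (fun s => expR (- (x * s)))).
Proof.
move=> x0; apply: (@measurable_le_integrable _ _ _ _ _ _ 1) => //.
    by rewrite -ge0_fin_numE// fin_num_measure.
  by apply: measurable_funTS; exact: measurable_expRNM.
move=> s; rewrite /= in_itv/= andbT => s0.
by rewrite ger0_norm ?expR_ge0// -expR0 ler_expR oppr_le0 mulr_ge0.
Qed.

Lemma laplaceE x : 0 <= x ->
  (\int[nu]_(s in `[0%R, +oo[) (expR (- (x * s)))%:E =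
   (expR (- (t * x `^ al)))%:E)%E.
Proof.
move=> x0; rewrite -laplace// /Rintegral fineK//.
by apply: integrable_fin_num => //; exact: integrable_expRNM.
Qed.

(** An atom of mass p at 0 would keep the Laplace transform above p everywhere, although it tends to
    0 at infinity. *)
Lemma stable_set1 : nu [set 0] = 0%E.
Proof.
apply/eqP; rewrite -measure_le0 leNgt; apply/negP => nu0.
have nufin : nu [set 0] \is a fin_num by rewrite fin_num_measure.
set p := fine (nu [set 0]).
have pE : nu [set 0] = p%:E by rewrite fineK.
have p0 : 0 < p by rewrite -lte_fin -pE.
(* Chosen so that the Laplace transform at [x] equals exp (-1/p). The resulting bound p <= exp
   (-1/p) contradicts exp (1/p) >= 1 + 1/p > 1/p. *)
pose x := (p^-1 / t) `^ al^-1.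
have x0 : 0 <= x by exact: powR_ge0.
have txE : t * x `^ al = p^-1.
  rewrite -powRrM mulVf ?gt_eqF// powRr1; last first.
    by rewrite divr_ge0 ?invr_ge0 ?(ltW p0) ?(ltW t0).
  by rewrite mulrC divfK// gt_eqF.
have : (p%:E <= (expR (- p^-1))%:E)%E.
  rewrite -pE -txE -laplaceE//.
  rewrite -[leLHS]mul1e -(@integral_cst _ _ _ nu [set 0] _ 1%:E)//.
  rewrite (@eq_integral _ _ _ nu _ (fun s => (expR (- (x * s)))%:E)).
    apply: ge0_subset_integral => //.
    - by apply/measurable_EFinP/measurable_funTS; exact: measurable_expRNM.
    - by move=> s ->; rewrite /= in_itv/= lexx.
  by move=> s; rewrite inE => ->; rewrite mulr0 oppr0 expR0.
rewrite lee_fin expRN -[X in X <= _]invrK lef_pV2 ?posrE ?invr_gt0 ?expR_gt0//.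
apply/negP; rewrite -ltNge.
by rewrite (lt_le_trans _ (expR_ge1Dx _))// ltrDr.
Qed.

Lemma Rintegral_itvoy (h : R -> R) : nu.-integrable `[0, +oo[ (EFin \o h) ->
  \int[nu]_(s in `[0, +oo[) h s = \int[nu]_(s in `]0, +oo[) h s.
Proof.
move=> ih; rewrite /Rintegral (@negligible_integral _ _ _ nu _ [set 0])//.
  by rewrite setDitv1l.
exact: stable_set1.
Qed.

Lemma integral_stable_powRN k : 1 <= k ->
  (\int[nu]_(s in `]0%R, +oo[) (s `^ (- k))%:E =
   (Gamma (k / al) / (al * t `^ (k / al) * Gamma k))%:E)%E.
Proof.
move=> k1.
have k0 : 0 < k by exact: lt_le_trans k1.
have kal : 1 <= k / al.
  by rewrite ler_pdivlMr// mul1r (le_trans _ k1)//; case/andP: al01.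
have G0 := Gamma_gt0 k1.
set I := LHS.
suff E : ((Gamma k)%:E * I = (Gamma (k / al) / (al * t `^ (k / al)))%:E)%E.
  rewrite [in RHS]invfM [in RHS]mulrA [in RHS]mulrC EFinM -E muleA -EFinM.
  by rewrite mulVf ?gt_eqF// mul1e.
(* [integral_powR_expR] is used twice: with [c = t] for the right-hand side here, and below with
   exponent 1 and [c = s] for the integrand on the left. *)
rewrite -integral_powR_expR// -ge0_integralZl//; last 3 first.
- by apply/measurable_EFinP/measurable_funTS; exact: measurable_powR.
- by move=> x _; rewrite lee_fin powR_ge0.
- by rewrite lee_fin ltW.
transitivity (\int[nu]_(s in `]0%R, +oo[) \int[leb]_(u in `]0%R, +oo[)
    (u `^ (k - 1) * expR (- (s * u)))%:E)%E.
  apply: eq_integral => s; rewrite inE/= in_itv/= andbT => s0.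
  have := @integral_powR_expR 1 k s ltr01.
  rewrite divr1 => /(_ k1 s0); rewrite mul1r -powRN EFinM => <-.
  apply: eq_integral => u; rewrite inE/= in_itv/= andbT => u0.
  by rewrite powRr1// ltW.
rewrite (@fubini_tonelli_in _ _ _ _ _ nu leb _ _
  (fun z : RB * RB => (z.2 `^ (k - 1) * expR (- (z.1 * z.2)))%:E))//=;
  last 2 first.
- apply/measurable_EFinP/measurable_funTS/measurable_funM.
    by apply: (measurableT_comp (measurable_powR _)).
  apply: measurableT_comp => //; apply: measurableT_comp => //.
  exact: measurable_funM.
- by move=> x y _ _; rewrite lee_fin mulr_ge0 ?powR_ge0 ?expR_ge0.
apply: eq_integral => u; rewrite inE/= in_itv/= andbT => u0.
under eq_integral do rewrite EFinM.
rewrite ge0_integralZl//; last 2 first.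
- apply/measurable_EFinP/measurable_funTS.
  apply: measurableT_comp => //; apply: measurableT_comp => //.
  exact: measurable_funM.
- by rewrite lee_fin powR_ge0.
rewrite EFinM -(laplaceE (ltW u0)).
(* The Laplace transform integrates over [0, +oo[ and the moment over ]0, +oo[; they are matched by
   discarding the null set {0}. *)
rewrite [in RHS](@ge0_negligible_integral _ _ _ nu _ [set 0])//; last 2 first.
- by apply/measurable_EFinP/measurable_funTS; exact: measurable_expRNM.
- exact: stable_set1.
rewrite setDitv1l; congr (_ * _)%E; apply: eq_integral => s _.
by rewrite mulrC.
Qed.

End stable.

(** * Bounds preserved by the Markov operators *)

Section markov_op.
Context {R : realType} d (T : measurableType d) (P : R -> R.-pker T ~> T).
Implicit Types (f : T -> R) (s : R) (x : T).

Lemma bounded_measurable_le f M : measurable_fun setT f ->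
  (forall z, `|f z| <= M) -> bounded_measurable f.
Proof.
move=> mf fM; split => //; exists M; split; first exact: num_real.
by move=> m Mm z _; apply: le_trans (fM z) (ltW Mm).
Qed.

Lemma bounded_measurable_bound f : bounded_measurable f ->
  exists M, forall z, `|f z| <= M.
Proof.
move=> [_ [M [_ fM]]]; exists (M + 1) => z.
by apply: fM => //; rewrite ltrDl.
Qed.

(** Each [P s x] is a probability, so constants are their own means. The bounds do not depend on
    [s], which later gives integrability in [s]. *)
Lemma markov_op_itv f (a b : R) s x : measurable_fun setT f ->
  (forall z, a <= f z <= b) -> a <= markov_op P s f x <= b.
Proof.
move=> mf fab.
have cstE (c : R) : c = \int[P s x]_y (cst c y).
  by rewrite Rintegral_cst// prob_kernel mulr1.
have PT : (P s x setT < +oo)%E by rewrite prob_kernel ltry.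
have icst (c : R) : (P s x).-integrable setT (EFin \o cst c).
  exact: (@measurable_le_integrable _ _ _ _ _ _ `|c|).
have fi : (P s x).-integrable setT (EFin \o f).
  apply: (@measurable_le_integrable _ _ _ _ _ _ (Num.max (- a) b)) => // z _.
  have /andP[az zb] := fab z.
  by rewrite ler_norml lerNl !le_max lerN2 az zb orbT.
apply/andP; split; [rewrite (cstE a)|rewrite (cstE b)].
- by apply: le_Rintegral => // z _; have /andP[] := fab z.
- by apply: le_Rintegral => // z _; have /andP[] := fab z.
Qed.

End markov_op.

(** * Integration of the log-Harnack inequality against the subordinator *)

Theorem theorem1p4 (R : realType) (E : polishType R)
    (P : R -> R.-pker (borel E) ~> (borel E))
    (hP : markov_semigroup P)
    (hPmeas : forall (f : borel E -> R) (x : borel E), bounded_measurable f ->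
      measurable_fun (`[0, +oo[%classic : set (measurableTypeR R))
        (fun s : measurableTypeR R => markov_op P s f x))
    (H : borel E * borel E -> R) (eps kappa : R)
    (hHmeas : measurable_fun setT H)
    (hH0 : forall z, 0 <= H z)
    (heps : 0 <= eps) (hkappa : 1 <= kappa)
    (hlogHarnack : forall (x y : borel E) (t : R), 0 < t ->
      forall f : borel E -> R, bounded_measurable f -> (forall z, 1 <= f z) ->
      markov_op P t (fun z => ln (f z)) x <=
        ln (markov_op P t f y) + H (x, y) * (eps + t `^ (- kappa))) :
  forall (alpha : R) (mu : R -> probability (measurableTypeR R) R),
    0 < alpha <= 1 -> stable_subordinator alpha mu ->
    forall (t : R) (x y : borel E), 0 < t ->
    forall f : borel E -> R, bounded_measurable f -> (forall z, 1 <= f z) ->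
    subordinate_op P mu t (fun z => ln (f z)) x <=
      ln (subordinate_op P mu t f y) +
      H (x, y) *
        (eps + Gamma (kappa / alpha) /
               (alpha * t `^ (kappa / alpha) * Gamma kappa)).
Proof.
move=> al mu al01 hmu t x y t0 f bf f1.
have /andP[al0 al1] := al01.
have laplace u : 0 <= u -> _ := fun u0 => stable_laplace hmu u0 (ltW t0).
have supp := csg_support (stable_csg hmu) (ltW t0).
have nu0 := stable_set1 t0 al01 laplace.
set nu := mu t in laplace supp nu0 *.
have nufin A : measurable A -> (nu A < +oo)%E.
  by move=> mA; rewrite -ge0_fin_numE// fin_num_measure.
have [M fM] := bounded_measurable_bound bf.
have mf := bf.1.
have f1M z : 1 <= f z <= M by rewrite f1/= (le_trans (ler_norm _)).
have M1 : 1 <= M by have /andP[] := f1M x; exact: le_trans.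
have lnf z : 0 <= ln (f z) <= ln M.
  have /andP[fz1 fzM] := f1M z; rewrite ln_ge0//= ler_ln ?posrE//.
  - exact: lt_le_trans fz1.
  - exact: lt_le_trans M1.
have mlnf : measurable_fun setT (fun z => ln (f z)).
  by apply: measurableT_comp mf; exact: measurable_ln.
have blnf : bounded_measurable (fun z => ln (f z)).
  apply: (bounded_measurable_le (M := ln M)) => // z.
  by have /andP[l0 lM] := lnf z; rewrite ger0_norm.
pose p s := markov_op P s f y.
pose q s := markov_op P s (fun z => ln (f z)) x.
have p1M s : 1 <= p s <= M by exact: markov_op_itv.
have q0M s : 0 <= q s <= ln M by exact: markov_op_itv.
have ip : nu.-integrable `[0, +oo[ (EFin \o p).
  apply: (@measurable_le_integrable _ _ _ _ _ _ M) => //.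
  - exact: nufin.
  - exact: hPmeas.
  - move=> s _; have /andP[ps1 psM] := p1M s.
    by rewrite ger0_norm// (le_trans ler01).
have iq : nu.-integrable `[0, +oo[ (EFin \o q).
  apply: (@measurable_le_integrable _ _ _ _ _ _ (ln M)) => //.
  - exact: nufin.
  - exact: hPmeas.
  - move=> s _; have /andP[qs0 qsM] := q0M s.
    by rewrite ger0_norm.
have oysub : `]0%R, +oo[ `<=` (`[0, +oo[%classic : set R).
  by apply: subset_itvr; rewrite bnd_simp.
have nuoy : nu `]0, +oo[%classic = 1%E.
  rewrite -supp -[LHS]mul1e -[RHS]mul1e -!integral_cst//.
  rewrite [RHS](@ge0_negligible_integral _ _ _ nu _ [set 0])//.
  by rewrite setDitv1l.
have subE h : nu.-integrable `[0, +oo[ (EFin \o h) ->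
    \int[nu]_(s in `[0, +oo[) h s = \int[nu]_(s in `]0, +oo[) h s.
  by move=> ih; exact: (Rintegral_itvoy t0 al01 laplace).
(* The log-Harnack inequality holds for positive times only, so both integrals are moved to ]0,
   +oo[. *)
rewrite /subordinate_op -/nu -/p -/q !subE//.
set m := \int[nu]_(s in `]0, +oo[) p s.
have ioy h : nu.-integrable `[0, +oo[ (EFin \o h) ->
    nu.-integrable `]0, +oo[ (EFin \o h).
  by apply: integrableS.
have icst (c : R) : nu.-integrable `]0, +oo[ (EFin \o cst c).
  by apply: (@measurable_le_integrable _ _ _ _ _ _ `|c|) => //; exact: nufin.
have cstE (c : R) : \int[nu]_(s in `]0, +oo[) c = c.
  by rewrite Rintegral_cst// [X in fine X]nuoy mulr1.
have m1 : 1 <= m.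
  rewrite -(cstE 1); apply: le_Rintegral => //; [exact: icst|exact: ioy|].
  by move=> s _; have /andP[] := p1M s.
have m0 : 0 < m by exact: lt_le_trans m1.
have powE := integral_stable_powRN t0 al01 laplace hkappa.
(* The explicit value of the moment also shows that it is finite. *)
have ipow : nu.-integrable `]0, +oo[ (EFin \o (fun s => s `^ (- kappa))).
  apply/integrableP; split.
    by apply/measurable_EFinP/measurable_funTS; exact: measurable_powR.
  under eq_integral do rewrite /= ger0_norm ?powR_ge0//.
  by rewrite powE ltry.
have ipm : nu.-integrable `]0, +oo[ (EFin \o (fun s => m^-1 * p s)).
  by have := integrableZl _ m^-1 (ioy _ ip); apply.
have iHpow : nu.-integrable `]0, +oo[
    (EFin \o (fun s => H (x, y) * s `^ (- kappa))).
  by have := integrableZl _ (H (x, y)) ipow; apply.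
(* [C] gathers the terms independent of [s] after ln (p s) is replaced by its tangent bound at the
   mean [m]. *)
set C := ln m - 1 + H (x, y) * eps.
have iD1 : nu.-integrable `]0, +oo[ (EFin \o (fun s => C + m^-1 * p s)).
  by have := integrableD _ (icst C) ipm; apply.
have iD2 : nu.-integrable `]0, +oo[
    (EFin \o (fun s => C + m^-1 * p s + H (x, y) * s `^ (- kappa))).
  by have := integrableD _ iD1 iHpow; apply.
apply: (@le_trans _ _ (\int[nu]_(s in `]0, +oo[)
    (C + m^-1 * p s + H (x, y) * s `^ (- kappa)))).
  apply: le_Rintegral => //; first exact: ioy.
  move=> s; rewrite /= in_itv/= andbT => s0.
  apply: le_trans (hlogHarnack x y s s0 f bf f1) _.
  have ps0 : 0 < p s by have /andP[+ _] := p1M s; exact: lt_le_trans.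
  have := ln_le_tangent m0 ps0; rewrite /C -/(p s).
  set L1 := ln _; set L2 := ln _; set X := p s / m.
  rewrite [m^-1 * p s]mulrC -/X.
  by move: (H (x, y)) => h; move: (s `^ _) => w; lra.
(* The mean of p / m is 1 and cancels the -1 in [C]; the power of [s] integrates to the Gamma
   quotient. *)
rewrite RintegralD// RintegralD//; last exact: icst.
rewrite (RintegralZl m^-1 _ (ioy _ ip))// (RintegralZl (H (x, y)) _ ipow)//.
rewrite cstE -/m mulVf ?gt_eqF//.
rewrite [X in H (x, y) * X](_ : _ =
    Gamma (kappa / al) / (al * t `^ (kappa / al) * Gamma kappa)).
  by rewrite /C; lra.
by rewrite /Rintegral powE.
Qed.
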